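(* Let $V_1,V_2$ be disjoint finite sets with $|V_1|=p$, $|V_2|=q$, $(p,q)\neq(0,0)$, and write $n=p+q$. (1) If $p\ge1$, then $\sum_{v\in V_1}\mu(m_v,\hat1)=(-1)^{n-1}\frac{(n-1)!}{(p-1)!}\,n^{p-1}$. Equivalently, when $n\ge2$, the sum over $v\in V_1$ of the dimensions of the unique nonvanishing reduced homology groups of the maximal intervals $[m_v,\hat1]$ equals $\frac{(n-1)!}{(p-1)!}n^{p-1}$. (2) If $p\ge1$, then the Möbius number of $\widehat\Pi(V_1,V_2)$ is $\mu(\hat0,\hat1)=(-1)^{n}\frac{(n-1)!}{(p-1)!}(n-1)^{p-1}$ (with $0^0=1$). Equivalently, the dimension of the unique nonvanishing reduced homology group of $\widehat\Pi(V_1,V_2)$ is $\frac{(n-1)!}{(p-1)!}(n-1)^{p-1}$. (3) The sum over all minimal elements $m$ of $\Pi(V_1,V_2)$ of $\mu(m,\hat1)$ equals $(-1)^{n-1}\frac{(n-1)!}{p!}\,n^{p}$. Equivalently, when $n\ge2$, the sum of the dimensions of the unique nonvanishing reduced homology groups of all maximal intervals of $\Pi(V_1,V_2)$ is $\frac{(n-1)!}{p!}n^p$.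
   Context: Let $V_1,V_2$ be disjoint finite sets, $V=V_1\sqcup V_2$. A semi-pointed partition of $(V_1,V_2)$ is a set partition of $V$ into nonempty blocks in which each block $B$ is either unpointed or pointed at one chosen element of $B\cap V_1$, subject to: a block contained in $V_1$ must be pointed, and a block contained in $V_2$ must be unpointed. $\Pi(V_1,V_2)$ is the set of semi-pointed partitions, ordered by: $P\le Q$ iff every block $b$ of $P$ is a union $q_1\cup\dots\cup q_r$ of blocks of $Q$, and if $b$ is pointed at $e$ then some $q_i$ is pointed at $e$, while if $b$ is unpointed then some $q_i$ is unpointed. Its greatest element $\hat1$ is the partition into singletons. Its minimal elements are $m_v$, $v\in V_1$ (the block $V$ pointed at $v$), and, if $V_2\neq\emptyset$, $m_\times$ (the unpointed block $V$). The maximal intervals are $[m,\hat1]$ for $m$ minimal. $\widehat\Pi(V_1,V_2)$ is $\Pi(V_1,V_2)$ with a new least element $\hat0$ adjoined. $\mu$ is the Möbius function. The homology of a bounded poset means the reduced homology over $\mathbb C$ of the order complex of its proper part. These posets are Cohen–Macaulay, so this homology is concentrated in one degree. *)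

(* Defs.v *)
From HB Require Import structures.
From mathcomp Require Import all_boot all_order all_algebra.
Set Implicit Arguments. Unset Strict Implicit. Unset Printing Implicit Defensive.
Import Order.TTheory GRing.Theory Num.Theory.

(* Generic Moebius function of a finite poset given by a carrier type U,
   a domain predicate D (the elements of the poset) and its order relation le.
   mu(x,x) = 1; mu(x,y) = - sum_{x <= z < y, z in D} mu(x,z) if x < y;
   mu(x,y) = 0 otherwise.  Recursion is fuelled by #|U|, which exceeds the
   length of any chain. *)
Fixpoint mobius_rec (U : finType) (D : pred U) (le : rel U) (k : nat) (x y : U)
  : int :=
  if x == y then 1%R else
  match k with
  | 0 => 0%R
  | k'.+1 =>
    if le x y then
      (- \sum_(z : U | [&& D z, le x z, le z y & z != y])
           mobius_rec D le k' x z)%R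
    else 0%R
  end.

Definition mobius (U : finType) (D : pred U) (le : rel U) (x y : U) : int :=
  mobius_rec D le #|U| x y.

(* A (candidate) semi-pointed partition of V = T (V1 a subset, V2 = ~: V1):
   a set of pairs (block, pointing), pointing = Some e (pointed at e) or None. *)
Notation spT T := {set ({set T} * option T)}.

Section SemiPointed.
Variable T : finType.
Variable V1 : {set T}.

Definition sp_valid (P : spT T) : bool :=
  [&& partition [set c.1 | c in P] [set: T],
      [forall c in P, forall d in P, (c.1 == d.1) ==> (c == d)],
      [forall c in P, if c.2 is Some e then e \in c.1 :&: V1 else true],
      [forall c in P, (c.1 \subset V1) ==> (c.2 != None)] &
      [forall c in P, (c.1 \subset ~: V1) ==> (c.2 == None)]].

Definition sp_le (P Q : spT T) : bool :=
  [forall c in P,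
     (c.1 == \bigcup_(d in Q | d.1 \subset c.1) d.1) &&
     [exists d in Q, (d.1 \subset c.1) && (d.2 == c.2)]].

Definition sp_mobius (P Q : spT T) : int := mobius sp_valid sp_le P Q.

Definition sp_minimal (m : spT T) : bool :=
  sp_valid m && [forall m', (sp_valid m' && sp_le m' m) ==> (m' == m)].

Definition sp_top : spT T :=
  [set ([set x], if x \in V1 then Some x else None) | x : T].

Definition sp_mv (v : T) : spT T := [set ([set: T], Some v)].

(* hat Pi(V1,V2) : None is the adjoined least element hat0 *)
Definition hat_valid (o : option (spT T)) : bool :=
  if o is Some P then sp_valid P else true.

Definition hat_le (o o' : option (spT T)) : bool :=
  match o, o' with
  | None, _ => true
  | Some _, None => false
  | Some P, Some Q => sp_le P Q
  end.

Definition hat_mobius (o o' : option (spT T)) : int :=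
  mobius hat_valid hat_le o o'.

End SemiPointed.

(* Main.v *)
Require Import Defs.
From HB Require Import structures.
From mathcomp Require Import all_boot all_order all_algebra.
From mathcomp Require Import ring zify.
Set Implicit Arguments. Unset Strict Implicit. Unset Printing Implicit Defensive.
Import Order.TTheory GRing.Theory Num.Theory.
Local Open Scope ring_scope.

(* Each of the three Moebius numbers, as a function g of the upper end Q of the
   interval, is the unique solution of a system "sum of g(P) over P <= Q is h(Q)",
   where h is respectively the indicator of the m_v, the constant -1 and the
   indicator of the minimal elements.  The ideal below Q is a copy of Pi(a, b)
   with a the number of pointed and b the number of unpointed blocks of Q, so
   that it suffices to guess g as a function of (a, b) and to sum it over
   Pi(p, q).  This sum is computed from an explicit count of the semi-pointed
   partitions by numbers of blocks, and collapses by an Abel-type identity: up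
   to boundary terms it is a p-th finite difference of a polynomial of degree
   less than p. *)

(** * Moebius functions *)

Section Mobius.
Variables (U : finType) (D : pred U) (le : rel U).
Hypothesis le_refl : forall x, D x -> le x x.
Hypothesis le_anti : forall x y, D x -> D y -> le x y -> le y x -> x = y.
Hypothesis le_trans : forall x y z,
  D x -> D y -> D z -> le x y -> le y z -> le x z.

Let below (y : U) := [set z | [&& D z, le z y & z != y]].

(** The size of the strict ideal grows strictly along the order: it is the measure for the fuel and
    for induction. *)
Lemma card_below x y : D x -> D y -> le x y -> x != y ->
  (#|below x| < #|below y|)%N.
Proof.
move=> Dx Dy xy nxy; apply: proper_card; apply/properP; split.
  apply/subsetP => z; rewrite !inE => /and3P[Dz zx nzx].
  rewrite Dz (le_trans Dz Dx Dy zx xy) /=; apply/eqP => zy.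
  by case/eqP: nzx; apply: le_anti => //; rewrite zy.
by exists x; rewrite !inE ?eqxx ?andbF // Dx xy.
Qed.

Lemma mobius_rec_fuel k k' x y : D x -> D y ->
  (#|below y| <= k)%N -> (#|below y| <= k')%N ->
  mobius_rec D le k x y = mobius_rec D le k' x y.
Proof.
elim: k k' y => [|k IH] [|k'] y Dx Dy ky ky' //=; case: eqP => // nxy.
- case: ifP => // xy.
  by move: ky; rewrite leqn0 => /eqP/cards0_eq/setP/(_ x);
     rewrite !inE Dx xy; move/eqP: nxy => ->.
- case: ifP => // xy.
  by move: ky'; rewrite leqn0 => /eqP/cards0_eq/setP/(_ x);
     rewrite !inE Dx xy; move/eqP: nxy => ->.
case: ifP => // xy; congr (- _); apply: eq_bigr => z /and4P[Dz xz zy nzy].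
have c := card_below Dz Dy zy nzy.
by apply: IH => //; rewrite -ltnS; apply: leq_trans c _.
Qed.

Lemma mobiusE x y : D x -> D y -> mobius D le x y =
  if x == y then 1 else if le x y then
   - \sum_(z | [&& D z, le x z, le z y & z != y]) mobius D le x z else 0.
Proof.
move=> Dx Dy; rewrite /mobius.
(* [y] is missing from its own strict ideal, so one unit of the fuel [#|U|] can be spent without
   changing the inner values. *)
have c : (#|below y| < #|U|)%N.
  rewrite -cardsT; apply: proper_card; rewrite properT; apply/eqP => /setP/(_ y).
  by rewrite !inE eqxx !andbF.
case: #|U| c => // k ck /=; case: eqP => // _; case: ifP => // xy.
congr (- _); apply: eq_bigr => z /and4P[Dz xz zy nzy].
have c := card_below Dz Dy zy nzy.
have ck' : (#|below z| <= k)%N by apply: ltnW; apply: leq_trans c _.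
exact: (@mobius_rec_fuel k k.+1 x z Dx Dz ck' (leqW ck')).
Qed.

(** Terms not above [x] vanish, so the sum may run over the whole ideal of [y]; this gives a system
    to which uniqueness applies. *)
Lemma sum_mobius x y : D x -> D y ->
  \sum_(z | D z && le z y) mobius D le x z = (x == y)%:R.
Proof.
move=> Dx Dy.
have -> : \sum_(z | D z && le z y) mobius D le x z =
    \sum_(z | [&& D z, le x z & le z y]) mobius D le x z.
  rewrite (bigID (le x)) /= [X in _ + X]big1 ?addr0.
    by apply: eq_bigl => z; rewrite -andbA [le z y && _]andbC.
  move=> z /andP[/andP[Dz zy] nxz]; rewrite mobiusE // (negPf nxz).
  by case: eqP => // xz; rewrite -xz le_refl in nxz.
case xy: (le x y); last first.
  have nxy : x != y by apply/eqP => e; rewrite -e le_refl in xy.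
  rewrite (negPf nxy) big1 // => z /and3P[Dz xz zy].
  by rewrite (le_trans Dx Dz Dy) in xy.
rewrite (bigD1 y) /=; last by rewrite Dy xy le_refl.
rewrite [in LHS]mobiusE // xy.
have -> : \sum_(z | [&& D z, le x z & le z y] && (z != y)) mobius D le x z =
    \sum_(z | [&& D z, le x z, le z y & z != y]) mobius D le x z.
  by apply: eq_bigl => z; rewrite -!andbA.
case: eqP => [e|_]; last by rewrite addNr.
rewrite big1 ?addr0 // => z /and4P[Dz xz zy nzy].
by case/eqP: nzy; apply: le_anti => //; rewrite -e.
Qed.

(** The system is triangular: the value at [y] is determined by those strictly below it. *)
Lemma ideal_sum_inj (R : zmodType) (f g : U -> R) :
  (forall y, D y -> \sum_(z | D z && le z y) f z = \sum_(z | D z && le z y) g z) ->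
  forall y, D y -> f y = g y.
Proof.
move=> fg y; elim: {y}_.+1 {-2}y (ltnSn #|below y|) => // k IH y ky Dy.
have := fg y Dy.
rewrite (bigD1 y) /=; last by rewrite Dy le_refl.
rewrite [RHS](bigD1 y) /=; last by rewrite Dy le_refl.
rewrite (eq_bigr g); first by move/addIr.
move=> z /andP[/andP[Dz zy] nzy]; apply: IH => //.
exact: leq_trans (card_below Dz Dy zy nzy) ky.
Qed.

End Mobius.

(** * Abel-type summation *)

Definition shift_diff (g : nat -> rat) (a : nat) : rat := g a.+1 - g a.

(* The [d]-th finite difference vanishes, i.e. [g] is a polynomial function of
   degree less than [d]. *)
Fixpoint vanishing (d : nat) (g : nat -> rat) : Prop :=
  if d is d'.+1 then vanishing d' (shift_diff g) else forall a, g a = 0.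

Lemma eq_vanishing d g h : g =1 h -> vanishing d g -> vanishing d h.
Proof.
elim: d g h => [|d IH] g h gh /= vg; first by move=> a; rewrite -gh.
by apply: IH vg => a; rewrite /shift_diff !gh.
Qed.

Lemma vanishingD d g h :
  vanishing d g -> vanishing d h -> vanishing d (fun a => g a + h a).
Proof.
elim: d g h => [|d IH] g h /= vg vh; first by move=> a; rewrite vg vh addr0.
by apply: eq_vanishing (IH _ _ vg vh) => a; rewrite /shift_diff; ring.
Qed.

Lemma vanishingZ d c g : vanishing d g -> vanishing d (fun a => c * g a).
Proof.
elim: d g => [|d IH] g /= vg; first by move=> a; rewrite vg mulr0.
by apply: eq_vanishing (IH _ vg) => a; rewrite /shift_diff; ring.
Qed.

Lemma vanishing0 d g : (forall a, g a = 0) -> vanishing d g.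
Proof.
elim: d g => [|d IH] g g0 //=.
by apply: IH => a; rewrite /shift_diff !g0 subr0.
Qed.

Lemma vanishingW d g : vanishing d g -> vanishing d.+1 g.
Proof.
elim: d g => [|d IH] g; last by move=> /= /IH.
exact: (@vanishing0 1).
Qed.

(** Discrete Leibniz rule: the difference of (c - a) g(a) is (c - 1 - a) times the difference of g,
    minus g(a). *)
Lemma vanishing_lin d c g :
  vanishing d g -> vanishing d.+1 (fun a => (c - a%:R) * g a).
Proof.
elim: d c g => [|d IH] c g vg.
  by apply: vanishing0 => a; rewrite vg mulr0.
have := vanishingD (IH (c - 1) _ vg) (vanishingZ (-1) vg).
by apply: eq_vanishing => a; rewrite /shift_diff -natr1; ring.
Qed.

(** Up to sign the sum is the [d]-th difference at 0: Pascal's rule turns the sum for [d.+1] and [g]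
    into minus that for [d] and [shift_diff g]. *)
Lemma alternating_sum_vanishing d g :
  vanishing d g -> \sum_(a < d.+1) (-1) ^+ a * 'C(d, a)%:R * g a = 0.
Proof.
elim: d g => [|d IH] g vg; first by rewrite big_ord1 vg mulr0.
rewrite big_ord_recl /= bin0.
under eq_bigr => i _ do
  rewrite /bump /= add1n binS natrD mulrDr mulrDl exprS mulN1r !mulNr.
rewrite big_split /= addrA !sumrN expr0 mul1r.
rewrite big_ord_recr /= bin_small // mulr0 mul0r addr0.
have /eqP := IH _ vg.
rewrite (eq_bigr _ (fun i _ => mulrBr _ _ _)) big_split /= sumrN subr_eq0.
move=> /eqP ->.
rewrite [in X in _ - X = _]big_ord_recl /= bin0 expr0 mul1r.
under [in X in _ - (X)]eq_bigr => i _ do rewrite /bump /= add1n exprS mulN1r !mulNr.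
by rewrite sumrN; ring.
Qed.

(* [stir a q f] is [\sum_b S_a(q, b) f b], where [S_a(q, b)] counts the ways to
   distribute a [q]-set over [a] marked, possibly empty cells and [b] unlabelled
   nonempty ones. *)
Fixpoint stir (a q : nat) (f : nat -> rat) : rat :=
  if q is q'.+1 then stir a q' (fun b => (a + b)%:R * f b + f b.+1) else f 0%N.

Lemma eq_stir a q f g : f =1 g -> stir a q f = stir a q g.
Proof.
elim: q f g => [|q IH] f g fg /=; first by rewrite fg.
by apply: IH => b; rewrite !fg.
Qed.

Lemma stirD a q f g : stir a q (fun b => f b + g b) = stir a q f + stir a q g.
Proof.
elim: q f g => [|q IH] f g //=; rewrite -IH.
by apply: eq_stir => b; ring.
Qed.

Lemma stirZ a q c f : stir a q (fun b => c * f b) = c * stir a q f.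
Proof.
elim: q f => [|q IH] f //=; rewrite -IH.
by apply: eq_stir => b; ring.
Qed.

Lemma stir0 a q : stir a q (fun=> 0) = 0.
Proof.
rewrite -[RHS](mul0r (stir a q (fun=> 0))) -stirZ.
by apply: eq_stir => b; rewrite mul0r.
Qed.

Lemma stir_sum a q n (f : nat -> nat -> rat) :
  stir a q (fun b => \sum_(i < n) f i b) = \sum_(i < n) stir a q (f i).
Proof.
elim: n => [|n IH].
  by rewrite big_ord0 -[RHS](stir0 a q); apply: eq_stir => b; rewrite big_ord0.
rewrite big_ord_recr /= -IH -stirD; apply: eq_stir => b.
by rewrite big_ord_recr.
Qed.

(** The falling factorial, at a rational [x] because negative arguments occur. *)
Definition fall (x : rat) (b : nat) : rat := \prod_(i < b) (x - i%:R).

Lemma fall0 x : fall x 0 = 1. Proof. by rewrite /fall big_ord0. Qed.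

Lemma fallSr x b : fall x b.+1 = fall x b * (x - b%:R).
Proof. by rewrite /fall big_ord_recr. Qed.

Lemma fallSl x b : fall x b.+1 = x * fall (x - 1) b.
Proof.
rewrite /fall big_ord_recl subr0; congr (_ * _).
by apply: eq_bigr => i _; rewrite /= /bump /= add1n -natr1; ring.
Qed.

(** For an integer [be >= a] both sides count the maps from a [q]-set to a [be]-set with [a] marked
    points. In general, with x = be - a, it follows from (a + b) (x)_b + (x)_(b+1) = be (x)_b. *)
Lemma stir_fall a q (be : rat) : stir a q (fall (be - a%:R)) = be ^+ q.
Proof.
elim: q => [|q IH] /=; first by rewrite fall0.
rewrite exprS -IH -stirZ; apply: eq_stir => b.
by rewrite fallSr natrD; ring.
Qed.

(* [n (be - a)_b = be (be - a)_b - (be - a) (be - 1 - a)_b] for [n = a + b], so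
   each factor [n] costs one degree in [a]. *)
Lemma stir_vanishing q k (be : rat) :
  vanishing k.+1
    (fun a => stir a q (fun b => (a + b)%:R ^+ k * fall (be - a%:R) b)).
Proof.
elim: k be => [|k IH] be.
  apply: (@eq_vanishing _ (fun=> be ^+ q)) => [a|a]; last exact: subrr.
  by rewrite -(stir_fall a); apply: eq_stir => b; rewrite expr0 mul1r.
have := vanishingD (vanishingW (vanishingZ be (IH be)))
  (vanishingZ (-1) (vanishing_lin be (IH (be - 1)))).
apply: eq_vanishing => a; rewrite -!stirZ -stirD; apply: eq_stir => b.
have -> : be - 1 - a%:R = be - a%:R - 1 by ring.
have := fallSl (be - a%:R) b; rewrite fallSr => e.
rewrite [X in _ + X](_ : _ = - ((a + b)%:R ^+ k *
  ((be - a%:R) * fall (be - a%:R - 1) b))); last by ring.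
by rewrite -e exprS natrD; ring.
Qed.

(* The polynomial [binom(a - 1, j)] in [a]; its value at [0] is [binom(-1, j)]. *)
Definition binp (j a : nat) : rat :=
  if a is a'.+1 then 'C(a', j)%:R else (-1) ^+ j.

(** The ratio (a - 1 - j)/(j + 1) is linear in [a]; it is written in the shape that [vanishing_lin]
    handles. *)
Lemma binpS j a : binp j.+1 a = j.+1%:R^-1 * - ((j.+1%:R - a%:R) * binp j a).
Proof.
have nz : j.+1%:R != 0 :> rat by rewrite pnatr_eq0.
apply: (mulfI nz); rewrite mulrA divff // mul1r.
case: a => [|a] /=; first by rewrite exprS; ring.
have [ja|aj] := leqP j a; last by rewrite !bin_small //; [ring|lia].
rewrite -natrM mul_bin_left natrM natrB // -!natr1; ring.
Qed.

Lemma vanishing_binp d j g :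
  vanishing d g -> vanishing (j + d) (fun a => binp j a * g a).
Proof.
move=> vg; elim: j => [|j IH].
  rewrite add0n; apply: eq_vanishing vg => -[|a] /=.
    by rewrite expr0 mul1r.
  by rewrite bin0 mul1r.
have := vanishingZ (- j.+1%:R^-1) (vanishing_lin j.+1%:R IH).
by apply: eq_vanishing => a; rewrite binpS; ring.
Qed.

(* Expanding [(al - n) ^ a] makes the exponent of [n] independent of [a]; the
   sums over [a] are then [p]-th finite differences of polynomials of degree
   less than [p], of which only the missing term [a = 0] survives. *)
Lemma abel_stir_sum p q (al be : rat) :
  \sum_(a < p) 'C(p, a.+1)%:R * stir a.+1 q (fun b => (a.+1 + b)%:R ^+ (p - a.+1)
      * ((al - (a.+1 + b)%:R) ^+ a * fall (be - a.+1%:R) b))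
  = \sum_(i < p) al ^+ i * stir 0 q (fun b => b%:R ^+ (p.-1 - i) * fall be b).
Proof.
pose G i a := stir a q (fun b => (a + b)%:R ^+ (p.-1 - i) * fall (be - a%:R) b).
have vG i : (i < p)%N -> vanishing p (fun a => binp i a * G i a).
  move=> ip; have := vanishing_binp i (stir_vanishing q (p.-1 - i) be).
  by have -> : (i + (p.-1 - i).+1 = p)%N by lia.
transitivity (\sum_(i < p) al ^+ i * ((-1) ^+ i * (- \sum_(a < p)
    (-1) ^+ a.+1 * 'C(p, a.+1)%:R * (binp i a.+1 * G i a.+1)))).
  under [RHS]eq_bigr => i _ do rewrite -sumrN !mulr_sumr.
  rewrite exchange_big /=; apply: eq_bigr => a _.
  have ap := ltn_ord a.
  transitivity ('C(p, a.+1)%:R * \sum_(i < p) al ^+ i * ((-1) ^+ (a - i) *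
     'C(a, i)%:R * G i a.+1)).
    congr (_ * _).
    under [RHS]eq_bigr => i _ do rewrite mulrA /G -stirZ.
    rewrite -(stir_sum _ _ _ (fun i b => al ^+ i * ((-1) ^+ (a - i) * 'C(a, i)%:R) *
        ((a.+1 + b)%:R ^+ (p.-1 - i) * fall (be - a.+1%:R) b))).
    apply: eq_stir => b.
    rewrite mulrA exprBn mulrC mulrA mulr_sumr.
    rewrite -(big_mkord xpredT (fun i => al ^+ i * ((-1) ^+ (a - i) * 'C(a, i)%:R) *
        ((a.+1 + b)%:R ^+ (p.-1 - i) * fall (be - a.+1%:R) b))).
    rewrite (big_cat_nat (n := a.+1)) //= big_mkord.
    (* Terms with i > a carry 'C(a, i) = 0, so [i] may range up to [p] for every [a]. *)
    rewrite [X in _ = _ + X]big1_seq ?addr0; last first.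
      by move=> i; rewrite mem_index_iota => /andP[_ /andP[ai _]];
         rewrite bin_small // mulr0 mulr0 mul0r.
    rewrite (reindex_inj rev_ord_inj) /=; apply: eq_bigr => i _.
    have ia : (i <= a)%N by rewrite -ltnS.
    rewrite subSS subKn //; move: (fall _ _) (a.+1 + b)%:R => F n.
    have -> : (p.-1 - i = (p - a.+1) + (a - i))%N by lia.
    rewrite exprD bin_sub // -[X in _ * X = _]mulr_natr.
    move: (n ^+ (p - a.+1)) (n ^+ (a - i)) ((-1) ^+ (a - i)) => u v w; ring.
  rewrite mulr_sumr; apply: eq_bigr => i _ /=.
  have [ia|ai] := leqP i a; last by rewrite (bin_small ai); ring.
  have s : (-1) ^+ (a - i) = (-1) ^+ a * (-1) ^+ i :> rat.
    by rewrite -signr_odd oddB // signr_addb !signr_odd.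
  by rewrite s exprS; ring.
apply: eq_bigr => i _; congr (_ * _).
(* The missing term [a = 0] has weight [binp i 0 = (-1) ^+ i], which cancels the sign kept in
   front. *)
have := alternating_sum_vanishing (vG i (ltn_ord i)).
rewrite big_ord_recl /= expr0 bin0 => /eqP; rewrite addr_eq0 => /eqP <-.
rewrite mul1r mul1r mulrA -expr2 sqrr_sign mul1r /G.
by apply: eq_stir => b; rewrite subr0.
Qed.

(* Choosing the [a] points among the [p] candidates, distributing the [q] others,
   then placing the remaining [p - a] candidates freely in the [a + b] blocks. *)
Definition ideal_sum (p q : nat) (F : nat -> nat -> rat) : rat :=
  \sum_(a < p.+1) 'C(p, a)%:R * stir a q (fun b => (a + b)%:R ^+ (p - a) * F a b).

Lemma ideal_sumE p q F : ideal_sum p q F =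
  stir 0 q (fun b => b%:R ^+ p * F 0%N b) +
  \sum_(a < p) 'C(p, a.+1)%:R *
    stir a.+1 q (fun b => (a.+1 + b)%:R ^+ (p - a.+1) * F a.+1 b).
Proof.
rewrite /ideal_sum big_ord_recl bin0 mul1r; congr (_ + _).
by apply: eq_stir => b; rewrite add0n subn0.
Qed.

(** * Closed forms of the three Moebius numbers *)

(** For [a > 0] the three guesses are the factor summed in [abel_stir_sum] at (al, be) = (0, 0), (0,
    -1) and, up to sign, (1, 0). Here the value at [a = 0] is 0, as no m_v lies below a partition
    without pointed blocks. *)
Definition mu_pointed (a b : nat) : rat :=
  if a is a'.+1 then (0 - (a + b)%:R) ^+ a' * fall (0 - a%:R) b else 0.

(** At [a = 0] and [b > 0] this is (-1)^(b-1) (b-1)!, the Moebius number of the lattice of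
    partitions of [b] blocks. *)
Definition mu_minimal (a b : nat) : rat :=
  if a is a'.+1 then (0 - (a + b)%:R) ^+ a' * fall (-1 - a%:R) b
  else if b is b'.+1 then fall (-1) b' else 0.

(** At [a = 0] and [b > 0] the ideal has the unpointed single block as least element, so the value
    is -1 for [b = 1] and 0 beyond. *)
Definition mu_hat (a b : nat) : rat :=
  - (if a is a'.+1 then (1 - (a + b)%:R) ^+ a' * fall (0 - a%:R) b
     else fall 1 b).

Lemma fall_zero b : fall 0 b = (b == 0%N)%:R.
Proof. by case: b => [|b]; rewrite ?fall0 // fallSl mul0r. Qed.

Lemma stir_delta q : stir 0 q (fun b => (b == 0%N)%:R) = (q == 0%N)%:R.
Proof.
by rewrite -expr0n -(stir_fall 0 q 0); apply: eq_stir => b; rewrite subr0 fall_zero.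
Qed.

(** [al = 0] leaves only [i = 0], and [be = 0] only [b = 0], where 0^(p-1) forces p = 1. *)
Lemma ideal_sum_pointed p q :
  ideal_sum p q mu_pointed = ((p == 1%N) && (q == 0%N))%:R.
Proof.
rewrite ideal_sumE (eq_stir _ _ (g := fun=> 0)) => [|b]; last by rewrite mulr0.
rewrite stir0 add0r abel_stir_sum.
case: p => [|p]; first by rewrite big_ord0.
rewrite big_ord_recl big1 => [|i _]; last by rewrite exprS mul0r mul0r.
rewrite addr0 expr0 mul1r eqSS subn0 /=.
case: p => [|p] /=.
  by rewrite -stir_delta; apply: eq_stir => b; rewrite mul1r fall_zero.
rewrite -[RHS](stir0 0 q); apply: eq_stir => -[|b]; first by rewrite exprS !mul0r.
by rewrite fall_zero mulr0.
Qed.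

(** By (-1)_b = - b (-1)_(b-1), the boundary term at [a = 0] cancels the only surviving term of the
    Abel sum, except at [b = 0]. *)
Lemma ideal_sum_minimal p q :
  ideal_sum p q mu_minimal = ((p + q)%N == 1%N)%:R.
Proof.
rewrite ideal_sumE abel_stir_sum.
case: p => [|p].
  rewrite big_ord0 addr0 add0n; case: q => //= q.
  (* Without an Abel sum, one step of the recursion of [stir] produces the same cancellation. *)
  rewrite eqSS -stir_delta; apply: eq_stir => -[|b] /=.
    by rewrite fall0 expr0 !mulr0 add0r mul1r.
  by rewrite !expr0 !mul1r fallSr add0n -natr1; ring.
rewrite big_ord_recl big1 => [|i _]; last by rewrite exprS mul0r mul0r.
rewrite addr0 expr0 mul1r -stirD subn0 addSn eqSS addn_eq0 /=.
have E b : b%:R ^+ p.+1 * mu_minimal 0 b + b%:R ^+ p * fall (-1) b =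
    (p == 0%N)%:R * (b == 0%N)%:R.
  case: b => [|b] /=; first by rewrite mulr0 add0r fall0 mulr1 expr0n mulr1.
  by rewrite fallSr mulr0 exprS -natr1; ring.
by rewrite (eq_stir _ _ E) stirZ stir_delta -natrM mulnb.
Qed.

(** For [p > 0] the boundary term is minus the indicator of [b = 1], and the Abel sum, where only
    [i = p - 1] survives, gives minus that of [b = 0]. Together they form [- fall 1 b], which [stir]
    sends to -1. *)
Lemma ideal_sum_hat p q : ideal_sum p q mu_hat = -1.
Proof.
rewrite ideal_sumE.
have -> : \sum_(a < p) 'C(p, a.+1)%:R *
    stir a.+1 q (fun b => (a.+1 + b)%:R ^+ (p - a.+1) * mu_hat a.+1 b) =
  - \sum_(a < p) 'C(p, a.+1)%:R *
    stir a.+1 q (fun b => (a.+1 + b)%:R ^+ (p - a.+1) *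
      ((1 - (a.+1 + b)%:R) ^+ a * fall (0 - a.+1%:R) b)).
  rewrite -sumrN; apply: eq_bigr => a _; rewrite -mulrN; congr (_ * _).
  rewrite -[RHS]mulN1r -stirZ; by apply: eq_stir => b; rewrite /mu_hat; ring.
rewrite abel_stir_sum.
have one : stir 0 q (fall 1) = 1.
  by have := stir_fall 0 q 1; rewrite subr0 expr1n.
case: p => [|p].
  rewrite big_ord0 subr0 -[in RHS]one -mulN1r -stirZ.
  by apply: eq_stir => b; rewrite /mu_hat expr0 mul1r mulN1r.
rewrite big_ord_recr big1 /= => [|i _]; last first.
  rewrite -[RHS](stir0 0 q) -stirZ; apply: eq_stir => -[|b]; last by rewrite fall_zero !mulr0.
  by rewrite expr0n subn_eq0 leqNgt ltn_ord !mul0r mulr0.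
rewrite add0r expr1n mul1r subnn -[X in _ + X]mulN1r -stirZ -stirD.
rewrite -[RHS]mulr1 -[X in _ = _ * X]one -stirZ.
apply: eq_stir => -[|b].
  by rewrite exprS !mul0r expr0 !fall0; ring.
rewrite /mu_hat fall_zero fallSl subrr fall_zero /=.
by case: b => [|b]; rewrite ?expr1n /=; ring.
Qed.

Lemma fall_opp (a b : nat) :
  fall (- a.+1%:R) b = (-1) ^+ b * ((a + b)`!%:R / a`!%:R).
Proof.
have nz n : n`!%:R != 0 :> rat by rewrite pnatr_eq0 -lt0n fact_gt0.
elim: b => [|b IH]; first by rewrite fall0 addn0 divff // mulr1.
rewrite fallSr IH addnS factS natrM exprS -!natr1 natrD; field.
exact: nz.
Qed.

Lemma mu_pointedE a b : (0 < a)%N ->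
  mu_pointed a b = (-1) ^+ (a + b).-1 * ((a + b).-1`!%:R / a.-1`!%:R)
    * (a + b)%:R ^+ a.-1.
Proof.
case: a => // a _; rewrite /mu_pointed !sub0r fall_opp (exprNn (a.+1 + b)%:R).
by rewrite addSn /= exprD; ring.
Qed.

Lemma mu_hatE a b : (0 < a)%N ->
  mu_hat a b = (-1) ^+ (a + b) * ((a + b).-1`!%:R / a.-1`!%:R)
    * (a + b).-1%:R ^+ a.-1.
Proof.
case: a => // a _; rewrite /mu_hat sub0r fall_opp addSn /= -natr1.
rewrite (_ : 1 - ((a + b)%:R + 1) = - (a + b)%:R); last by ring.
by rewrite (exprNn (a + b)%:R) exprS exprD; ring.
Qed.

Lemma mu_minimalE a b : (0 < a + b)%N ->
  mu_minimal a b = (-1) ^+ (a + b).-1 * ((a + b).-1`!%:R / a`!%:R)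
    * (a + b)%:R ^+ a.
Proof.
case: a => [|a] /=.
  case: b => // b _; have := fall_opp 0 b; rewrite add0n /= fact0 => ->.
  by rewrite expr0; ring.
move=> _; rewrite sub0r (_ : -1 - a.+1%:R = - a.+2%:R); last by rewrite -!natr1; ring.
(* With n = a + b + 1, the factor n of n! raises the exponent of n by one. *)
rewrite fall_opp (exprNn (a.+1 + b)%:R) !addSn /= factS natrM exprD exprS; ring.
Qed.

(** * Semi-pointed partitions *)

Local Notation rk d := (nat_of_ord (enum_rank d)).

Section Blocks.
Variables (T : finType) (V1 : {set T}).
Implicit Types (P Q : spT T) (c d i : {set T} * option T).

(** Elementwise form of [sp_valid]; [block_eq] expresses both disjointness and that a block carries
    only one pointing. *)
Record semi_pointed P : Prop := SemiPointed {
  block_cover : forall x, exists2 c, c \in P & x \in c.1;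
  block_eq : forall c d x, c \in P -> d \in P -> x \in c.1 -> x \in d.1 -> c = d;
  block_inh : forall c, c \in P -> exists x, x \in c.1;
  block_point : forall c e, c \in P -> c.2 = Some e -> e \in c.1 /\ e \in V1;
  block_unpointed : forall c, c \in P -> c.2 = None ->
    exists2 x, x \in c.1 & x \notin V1 }.

Lemma sp_validP P : reflect (semi_pointed P) (sp_valid V1 P).
Proof.
apply: (iffP idP).
- case/and5P=> /and3P[/eqP cov tri n0] /forallP inj /forallP pt /forallP un _.
  have eqb c d : c \in P -> d \in P -> c.1 = d.1 -> c = d.
    move=> cP dP e; have := inj c; rewrite cP /= => /forallP/(_ d).
    by rewrite dP /= e eqxx => /eqP.
  have inb c : c \in P -> c.1 \in [set c.1 | c in P] by move=> cP; apply: imset_f.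
  split.
  + move=> x; have : x \in cover [set c.1 | c in P] by rewrite cov inE.
    by case/bigcupP => B /imsetP[c cP ->]; exists c.
  + move=> c d x cP dP xc xd; apply: eqb => //.
    by rewrite -(def_pblock tri (inb _ cP) xc) (def_pblock tri (inb _ dP) xd).
  + move=> c cP; apply/set0Pn; apply/eqP => c0; case/negP: n0.
    by rewrite -c0 inb.
  + move=> c e cP ce; have := pt c; rewrite cP ce /= inE => /andP[]; by [].
  + move=> c cP ce; have := un c; rewrite cP ce /= implybF.
    by case/subsetPn => x xc xV; exists x.
- case=> cov uniq ne pt un.
  have pt' : [forall c in P, if c.2 is Some e then e \in c.1 :&: V1 else true].
    apply/forallP => c; apply/implyP => cP; case ce: c.2 => [e|//].
    by have [? ?] := pt c e cP ce; apply/setIP.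
  apply/and5P; split=> //.
  + apply/and3P; split.
    * rewrite eqEsubset subsetT /=; apply/subsetP => x _.
      have [c cP xc] := cov x; apply/bigcupP; exists c.1 => //.
      exact: imset_f.
    * apply/trivIsetP => A B /imsetP[c cP ->] /imsetP[d dP ->] ncd.
      rewrite -setI_eq0; apply/eqP/setP => x; rewrite !inE.
      by apply/negP => /andP[xc xd]; rewrite (uniq _ _ x cP dP) ?eqxx in ncd.
    * apply/imsetP => -[c cP c0]; have [x] := ne c cP.
      by rewrite -c0 inE.
  + apply/forallP => c; apply/implyP => cP; apply/forallP => d; apply/implyP => dP.
    apply/implyP => /eqP e; apply/eqP.
    by have [x xc] := ne c cP; apply: (uniq _ _ x) => //; rewrite -e.
  + apply/forallP => c; apply/implyP => cP; apply/implyP => /subsetP sub.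
    apply/eqP => ce; have [x xc] := un c cP ce.
    by rewrite sub.
  + apply/forallP => c; apply/implyP => cP; apply/implyP => /subsetP sub.
    case ce: c.2 => [e|//]; have [ec eV] := pt c e cP ce.
    by have := sub _ ec; rewrite inE eV.
Qed.

Lemma semi_pointed_sub_eq P Q :
  semi_pointed P -> semi_pointed Q -> P \subset Q -> P = Q.
Proof.
move=> vP vQ /subsetP PQ; apply/eqP; rewrite eqEsubset; apply/andP.
split; apply/subsetP => // d dQ.
have [x xd] := block_inh vQ dQ; have [c cP xc] := block_cover vP x.
by rewrite (block_eq vQ dQ (PQ _ cP) xd xc).
Qed.

(** As both families of blocks cover [T], the union condition amounts to every block of [Q] lying
    inside a block of [P]. *)
Lemma sp_leP P Q : semi_pointed P -> semi_pointed Q ->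
  reflect ((forall d, d \in Q -> exists2 c, c \in P & d.1 \subset c.1) /\
    (forall c, c \in P -> exists d, [/\ d \in Q, d.1 \subset c.1 & d.2 = c.2]))
  (sp_le P Q).
Proof.
move=> vP vQ; apply: (iffP idP).
- move=> /forallP h; split.
  + move=> d dQ; have [x xd] := block_inh vQ dQ.
    have [c cP xc] := block_cover vP x; exists c => //.
    have := h c; rewrite cP /= => /andP[/eqP e _].
    move: xc; rewrite e => /bigcupP[d' /andP[d'Q d'c] xd'].
    by rewrite (block_eq vQ dQ d'Q xd xd') -e.
  + move=> c cP; have := h c; rewrite cP /= => /andP[_ /existsP[d]].
    by case/and3P=> dQ dc /eqP e; exists d.
- case=> h1 h2; apply/forallP => c; apply/implyP => cP; apply/andP; split.
  + rewrite eqEsubset; apply/andP; split; apply/subsetP => x.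
    * move=> xc; have [d dQ xd] := block_cover vQ x.
      have [c' c'P /subsetP dc'] := h1 d dQ.
      apply/bigcupP; exists d => //; rewrite dQ /=; apply/subsetP => y yd.
      by rewrite (block_eq vP cP c'P xc (dc' _ xd)) dc'.
    * by case/bigcupP => d /andP[dQ /subsetP dc] /dc.
  + have [d [dQ dc e]] := h2 c cP.
    by apply/existsP; exists d; rewrite dQ dc e eqxx.
Qed.

Lemma sp_le_refl P : sp_valid V1 P -> sp_le P P.
Proof.
move=> /sp_validP vP; apply/(sp_leP vP vP).
by split=> c cP; exists c.
Qed.

Lemma sp_le_trans P Q R : sp_valid V1 P -> sp_valid V1 Q -> sp_valid V1 R ->
  sp_le P Q -> sp_le Q R -> sp_le P R.
Proof.
move=> /sp_validP vP /sp_validP vQ /sp_validP vR.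
move=> /(sp_leP vP vQ)[pq1 pq2] /(sp_leP vQ vR)[qr1 qr2].
apply/(sp_leP vP vR); split.
- move=> e /qr1[d dQ ed]; have [c cP dc] := pq1 d dQ.
  by exists c => //; apply: subset_trans dc.
- move=> c /pq2[d [dQ dc e]]; have [f [fR fd e']] := qr2 d dQ.
  by exists f; rewrite e' (subset_trans fd dc).
Qed.

Lemma sp_le_anti P Q : sp_valid V1 P -> sp_valid V1 Q ->
  sp_le P Q -> sp_le Q P -> P = Q.
Proof.
move=> /sp_validP vP /sp_validP vQ.
move=> /(sp_leP vP vQ)[pq1 pq2] /(sp_leP vQ vP)[qp1 qp2].
apply: semi_pointed_sub_eq => //; apply/subsetP => c cP.
have [d [dQ dc e]] := pq2 c cP; have [d' d'Q cd'] := qp1 c cP.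
have [x xd] := block_inh vQ dQ.
have E : d = d'.
  by apply: (block_eq vQ dQ d'Q xd); apply/(subsetP cd')/(subsetP dc).
suff -> : c = d by [].
move: dc e cd'; rewrite -E; case: c {cP} => c1 c2; case: (d) => d1 d2 /= dc -> cd.
by congr pair; apply/eqP; rewrite eqEsubset cd.
Qed.

End Blocks.

(** * Encoding of the ideal below a partition by retractions *)

Section Glue.
Variables (T : finType) (V1 : {set T}) (Q : spT T).
Hypothesis vQ : semi_pointed V1 Q.
Local Notation U := ({set T} * option T)%type.
Implicit Types (P : spT T) (c d i : U) (r : {ffun U -> U}).

(* A semi-pointed partition below [Q] is encoded by the map sending each block
   of [Q] to the representative of the block of [P] that contains it: the block
   of [Q] carrying the same point when that block is pointed, and its
   unpointed block of least rank otherwise. *)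
Definition retraction r : bool :=
  [forall d, if d \in Q then
     [&& r d \in Q, r (r d) == r d &
         [&& d.2 == None & (r d).2 == None] ==> (rk (r d) <= rk d)%N]
   else r d == d].

Definition fiber r i : U := (\bigcup_(d in Q | r d == i) d.1, i.2).

Definition glue r : spT T := [set fiber r i | i in r @: Q].

(** The candidates for representing [d]: blocks of [Q] in the same block of [P] that carry the
    pointing of that block. *)
Definition admissible P d d' : bool :=
  (d' \in Q) && [exists c in P, [&& d.1 \subset c.1, d'.1 \subset c.1 & d'.2 == c.2]].

(** A pointed block of [P] leaves a single candidate; least rank decides among unpointed ones. The
    identity outside [Q] is a normal form that makes the encoding injective. *)
Definition unglue P : {ffun U -> U} :=
  [ffun d => if d \in Q then odflt d [pick d' | admissible P d d' &&
      [forall d'', admissible P d d'' ==> (rk d' <= rk d'')%N]] else d].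

Lemma retraction_in r d : retraction r -> d \in Q -> r d \in Q.
Proof. by move=> /forallP/(_ d) h dQ; move: h; rewrite dQ => /and3P[]. Qed.

Lemma retraction_idem r d : retraction r -> d \in Q -> r (r d) = r d.
Proof. by move=> /forallP/(_ d) h dQ; move: h; rewrite dQ => /and3P[_ /eqP]. Qed.

Lemma retraction_rank r d : retraction r -> d \in Q ->
  d.2 = None -> (r d).2 = None -> (rk (r d) <= rk d)%N.
Proof.
move=> /forallP/(_ d) h dQ e e'; move: h; rewrite dQ => /and3P[_ _].
by rewrite e e'.
Qed.

Lemma retraction_out r d : retraction r -> d \notin Q -> r d = d.
Proof. by move=> /forallP/(_ d) h dQ; move: h; rewrite (negPf dQ) => /eqP. Qed.

Lemma retraction_fix r i : retraction r -> i \in r @: Q -> i \in Q /\ r i = i.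
Proof.
move=> rr /imsetP[d dQ ->]; split; first exact: retraction_in.
exact: retraction_idem.
Qed.

Lemma mem_fiber r i d x : d \in Q -> x \in d.1 -> (x \in (fiber r i).1) = (r d == i).
Proof.
move=> dQ xd; apply/bigcupP/eqP => [[d' /andP[d'Q /eqP <-] xd']|<-].
  by rewrite (block_eq vQ dQ d'Q xd xd').
by exists d; rewrite ?dQ ?eqxx.
Qed.

Lemma sub_fiber r i d : d \in Q -> (d.1 \subset (fiber r i).1) = (r d == i).
Proof.
move=> dQ; apply/subsetP/eqP => [sub|<- x xd].
  have [x xd] := block_inh vQ dQ.
  by have := sub _ xd; rewrite (mem_fiber _ _ dQ) // => /eqP.
by rewrite (mem_fiber _ _ dQ).
Qed.

Lemma glue_semi_pointed r : retraction r -> semi_pointed V1 (glue r).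
Proof.
move=> rr; split.
- move=> x; have [d dQ xd] := block_cover vQ x.
  by exists (fiber r (r d)); rewrite ?(mem_fiber _ _ dQ) //; do 2!apply: imset_f.
- move=> c d x /imsetP[i iQ ->] /imsetP[j jQ ->].
  have [e eQ xe] := block_cover vQ x.
  by rewrite !(mem_fiber _ _ eQ) // => /eqP <- /eqP <-.
- move=> c /imsetP[i /(retraction_fix rr)[iQ ii] ->].
  have [x xi] := block_inh vQ iQ.
  by exists x; rewrite (mem_fiber _ _ iQ) // ii.
- move=> c e /imsetP[i /(retraction_fix rr)[iQ ii] ->] /= ie.
  have [ei eV] := block_point vQ iQ ie.
  by split=> //; rewrite (mem_fiber _ _ iQ) ?ii.
- move=> c /imsetP[i /(retraction_fix rr)[iQ ii] ->] /= ie.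
  have [x xi xV] := block_unpointed vQ iQ ie.
  by exists x => //; rewrite (mem_fiber _ _ iQ) ?ii.
Qed.

Lemma glue_le r : retraction r -> sp_le (glue r) Q.
Proof.
move=> rr; apply/(sp_leP (glue_semi_pointed rr) vQ); split.
- move=> d dQ; exists (fiber r (r d)); last by rewrite sub_fiber.
  by do 2!apply: imset_f.
- move=> c /imsetP[i /(retraction_fix rr)[iQ ii] ->].
  by exists i; rewrite sub_fiber // ii.
Qed.

Lemma unglueP P d d0 : d \in Q -> admissible P d d0 ->
  admissible P d (unglue P d) /\
  forall d', admissible P d d' -> (rk (unglue P d) <= rk d')%N.
Proof.
move=> dQ ad0; rewrite ffunE dQ; case: pickP => [d' /andP[ad' /forallP h]|h] /=.
  by split=> // d'' ad''; have := h d''; rewrite ad''.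
have [m am hm] := arg_minnP (fun d' => rk d') ad0.
case/negP: (negbT (h m)); rewrite am /=; apply/forallP => d''; apply/implyP.
exact: hm.
Qed.

Lemma unglue_eq P d d0 : d \in Q -> admissible P d d0 ->
  (forall d', admissible P d d' -> (rk d0 <= rk d')%N) -> unglue P d = d0.
Proof.
move=> dQ ad0 h; have [au hu] := unglueP dQ ad0.
by apply/enum_rank_inj/ord_inj/eqP; rewrite eqn_leq hu //= h.
Qed.

Lemma glueK r : retraction r -> unglue (glue r) = r.
Proof.
move=> rr; apply/ffunP => d; have [dQ|dQ] := boolP (d \in Q); last first.
  by rewrite ffunE (negPf dQ) (retraction_out rr dQ).
have rQ := retraction_in rr dQ; have ri := retraction_idem rr dQ.
apply: unglue_eq => //.
  rewrite /admissible rQ; apply/existsP; exists (fiber r (r d)).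
  rewrite !sub_fiber // ri !eqxx !andbT /=.
  by do 2!apply: imset_f.
move=> d' /andP[d'Q /existsP[c /and4P[/imsetP[i _ ->]]]].
rewrite !sub_fiber // => /eqP <- /eqP e /eqP /= e2.
(* A point determines its block in [Q]; for an unpointed representative the rank clause of
   [retraction] gives minimality. *)
case e3: (r d).2 => [v|].
  have [vd _] := block_point vQ rQ e3.
  rewrite e3 in e2; have [vd' _] := block_point vQ d'Q e2.
  by rewrite (block_eq vQ rQ d'Q vd vd').
rewrite -e; apply: retraction_rank => //; first by rewrite e2.
by rewrite e.
Qed.

Section UnglueIdeal.
Variable P : spT T.
Hypotheses (vP : semi_pointed V1 P) (PQ : sp_le P Q).

Lemma admissibleE d c d' : d \in Q -> c \in P -> d.1 \subset c.1 ->
  admissible P d d' = [&& d' \in Q, d'.1 \subset c.1 & d'.2 == c.2].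
Proof.
move=> dQ cP dc; rewrite /admissible; case d'Q: (d' \in Q) => //=.
apply/existsP/idP => [[c' /and4P[c'P dc' d'c' e]]|/andP[d'c e]]; last first.
  by exists c; rewrite cP dc d'c.
have [x xd] := block_inh vQ dQ.
by rewrite (block_eq vP cP c'P (subsetP dc _ xd) (subsetP dc' _ xd)) d'c'.
Qed.

Lemma unglue_block d c : d \in Q -> c \in P -> d.1 \subset c.1 ->
  [/\ unglue P d \in Q, (unglue P d).1 \subset c.1 & (unglue P d).2 = c.2].
Proof.
move=> dQ cP dc; have /(sp_leP vP vQ)[_ /(_ c cP)[d0 [d0Q d0c e]]] := PQ.
have ad0 : admissible P d d0 by rewrite (admissibleE _ dQ cP dc) d0Q d0c e eqxx.
have [] := unglueP dQ ad0; rewrite (admissibleE _ dQ cP dc) => /and3P[? ? /eqP ?].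
by [].
Qed.

Lemma unglue_rank d c d' : d \in Q -> c \in P -> d.1 \subset c.1 ->
  d' \in Q -> d'.1 \subset c.1 -> d'.2 = c.2 -> (rk (unglue P d) <= rk d')%N.
Proof.
move=> dQ cP dc d'Q d'c e.
have ad' : admissible P d d' by rewrite (admissibleE _ dQ cP dc) d'Q d'c e eqxx.
by have [_] := unglueP dQ ad'; apply.
Qed.

(** Each of the two values is a candidate for the other block, so least rank makes them equal. *)
Lemma unglue_const d d' c : d \in Q -> d' \in Q -> c \in P ->
  d.1 \subset c.1 -> d'.1 \subset c.1 -> unglue P d = unglue P d'.
Proof.
move=> dQ d'Q cP dc d'c.
have [u1 u2 u3] := unglue_block dQ cP dc; have [w1 w2 w3] := unglue_block d'Q cP d'c.
apply/enum_rank_inj/ord_inj/eqP; rewrite eqn_leq.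
by rewrite (unglue_rank dQ cP) // (unglue_rank d'Q cP).
Qed.

Lemma unglue_retraction : retraction (unglue P).
Proof.
apply/forallP => d; case dQ: (d \in Q); last by rewrite ffunE dQ.
have /(sp_leP vP vQ)[/(_ d dQ)[c cP dc] _] := PQ.
have [u1 u2 u3] := unglue_block dQ cP dc.
rewrite u1 (unglue_const u1 dQ cP u2 dc) eqxx /=.
(* If the representative is unpointed, an unpointed [d] is itself a candidate. *)
apply/implyP => /andP[/eqP e /eqP e'].
by apply: (unglue_rank dQ cP dc dQ dc); rewrite -u3 e e'.
Qed.

Lemma unglueK : glue (unglue P) = P.
Proof.
have vG := glue_semi_pointed unglue_retraction.
apply: semi_pointed_sub_eq vG vP _; apply/subsetP => _ /imsetP[_ /imsetP[d dQ ->] ->].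
have /(sp_leP vP vQ)[sub _] := PQ.
have [c cP dc] := sub d dQ.
have [u1 u2 u3] := unglue_block dQ cP dc.
suff -> : fiber (unglue P) (unglue P d) = c by [].
rewrite /fiber u3 [RHS]surjective_pairing; congr pair.
apply/setP => x; have [d' d'Q xd'] := block_cover vQ x.
have := mem_fiber (unglue P) (unglue P d) d'Q xd'; rewrite /fiber /= => ->.
have [c' c'P d'c'] := sub d' d'Q.
have [w1 w2 w3] := unglue_block d'Q c'P d'c'.
apply/eqP/idP => [e|xc].
  have [y yu] := block_inh vQ u1.
  have yc' : y \in c'.1 by apply: (subsetP w2); rewrite e.
  have E := block_eq vP cP c'P (subsetP u2 _ yu) yc'.
  by have := subsetP d'c' _ xd'; rewrite -E.
have E := block_eq vP cP c'P xc (subsetP d'c' _ xd').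
by apply: (unglue_const d'Q dQ cP) => //; rewrite E.
Qed.

End UnglueIdeal.

Lemma fiber_inj r : retraction r -> {in r @: Q &, injective (fiber r)}.
Proof.
move=> rr i j /(retraction_fix rr)[iQ ii] /(retraction_fix rr)[jQ jj] e.
have : i.1 \subset (fiber r j).1 by rewrite -e sub_fiber // ii.
by rewrite sub_fiber // ii => /eqP.
Qed.

(** A glued block inherits the pointing of its representative, and [fiber] is injective on
    representatives. *)
Lemma card_glue r (b : pred (option T)) : retraction r ->
  #|[set c in glue r | b c.2]| = #|[set i in r @: Q | b i.2]|.
Proof.
move=> rr.
have -> : [set c in glue r | b c.2] = fiber r @: [set i in r @: Q | b i.2].
  apply/setP => c; rewrite !inE; apply/andP/imsetP.
    by case=> /imsetP[i iQ ->] bi; exists i => //; rewrite inE iQ.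
  by case=> i; rewrite inE => /andP[iQ bi] ->; split=> //; apply: imset_f.
rewrite card_in_imset // => i j; rewrite !inE => /andP[iQ _] /andP[jQ _].
exact: fiber_inj.
Qed.

End Glue.

(** * Sums over subsets *)

Section SubsetSums.
Variable U : finType.
Implicit Types (A B I Q S : {set U}).

Lemma sum_subsetU1 (z : U) S (F : {set U} -> rat) : z \notin S ->
  \sum_(B : {set U} | B \subset z |: S) F B =
  \sum_(B : {set U} | B \subset S) (F B + F (z |: B)).
Proof.
move=> zS; rewrite (bigID (fun B : {set U} => z \in B)) /= addrC big_split /=.
congr (_ + _).
  apply: eq_bigl => B; apply/andP/idP => [[/subsetP BS zB]|BS].
    apply/subsetP => x xB; have := BS x xB; rewrite !inE.
    by case/orP => // /eqP e; rewrite -e xB in zB.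
  split; first exact: subset_trans BS (subsetUr _ _).
  by apply: contra zS; apply: subsetP.
rewrite (reindex_onto (fun B : {set U} => z |: B)
  (fun B : {set U} => B :\ z)) /=; last first.
  by move=> B /andP[_ zB]; rewrite setD1K.
apply: eq_bigl => B; rewrite setU11 andbT.
apply/andP/idP => [[/subsetP BS /eqP e]|BS].
  apply/subsetP => x xB; have xz : x != z.
    by apply/eqP => xz; rewrite -e xz !inE eqxx in xB.
  by have := BS x; rewrite !inE xB orbT (negPf xz) => /(_ isT).
have zB : z \notin B by apply: contra zS; apply: subsetP.
split; first exact: setUS.
by rewrite setU1K.
Qed.

(** [B] plays the set of least elements of the unlabelled cells: any other [x] joins one of [a]
    marked cells or a cell whose least element has smaller rank. The induction removes the element
    of largest rank. *)
Lemma sum_subset_stir (a : nat) Q (f : nat -> rat) :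
  \sum_(B : {set U} | B \subset Q) f #|B| *
     \prod_(x in Q :\: B) (a + #|[set i in B | (rk i < rk x)%N]|)%:R
  = stir a #|Q| f.
Proof.
move eq: #|Q| => q; elim: q Q eq f => [|q IH] Q Qq f.
  have -> : Q = set0 by apply/cards0_eq.
  rewrite (eq_bigl (pred1 set0)) => [|B]; last by rewrite subset0.
  by rewrite big_pred1_eq cards0 set0D big_set0 mulr1.
have [z0 z0Q] : exists z, z \in Q by apply/card_gt0P; rewrite Qq.
have [z zQ0 zmax] := arg_maxnP (fun z : U => rk z) z0Q; have zQ : z \in Q := zQ0.
have lt_z x : x \in Q :\ z -> (rk x < rk z)%N.
  rewrite !inE => /andP[xz xQ]; rewrite ltn_neqAle.
  have -> : (rk x <= rk z)%N by apply: zmax.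
  rewrite andbT; apply: contra xz => /eqP e; apply/eqP.
  exact/enum_rank_inj/ord_inj.
have Qz : #|Q :\ z| = q by move: Qq; rewrite (cardsD1 z) zQ => -[].
(* If [z] is not chosen it has [a + #|B|] options; if chosen it adds a cell and, its rank being
   largest, no option for the others. *)
rewrite -{1}(setD1K zQ) sum_subsetU1 ?setD11 //= -(IH _ Qz); apply: eq_bigr => B BQ.
have zB : z \notin B by apply/negP => /(subsetP BQ); rewrite !inE eqxx.
rewrite mulrDl cardsU1 zB add1n; congr (_ + _ * _).
  rewrite (bigD1 z) /=; last by rewrite !inE zB.
  rewrite [X in _ = X * _]mulrC -mulrA; congr (_ * (_%:R * _)).
    congr (_ + _)%N; apply: eq_card => i; rewrite !inE.
    by case iB: (i \in B) => //=; rewrite lt_z // (subsetP BQ).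
  by apply: eq_bigl => x; rewrite !inE; case: eqP; rewrite ?andbF ?andbT.
apply: eq_big => [x|x xQ]; first by rewrite !inE; case: (x == z); case: (x \in B).
congr (_ + _)%:R; apply: eq_card => i; rewrite !inE.
case: eqP => //= ->; rewrite (negPf zB) /=.
apply/negbTE; rewrite -leqNgt ltnW // lt_z //.
by move: xQ; rewrite !inE negb_or => /andP[/andP[-> _] ->].
Qed.

Lemma sum_subset_card Q (f : nat -> rat) :
  \sum_(A : {set U} | A \subset Q) f #|A| = \sum_(a < #|Q|.+1) 'C(#|Q|, a)%:R * f a.
Proof.
rewrite (partition_big (fun A : {set U} => inord #|A| : 'I_#|Q|.+1) xpredT) //=.
apply: eq_bigr => a _.
rewrite -cards_draws -[X in X%:R]sum1_card natr_sum mulr_suml; apply: eq_big => [A|A].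
  rewrite inE; case AQ: (A \subset Q) => //=.
  by rewrite -val_eqE /= inordK // ltnS subset_leq_card.
case/andP=> AQ /eqP <-; rewrite inordK ?mul1r // ltnS.
exact: subset_leq_card.
Qed.

Lemma sum_subset_pair (Q : {set U}) (b : pred U) (F : {set U} -> {set U} -> rat) :
  \sum_(I : {set U} | I \subset Q) F [set i in I | b i] [set i in I | ~~ b i] =
  \sum_(A : {set U} | A \subset [set i in Q | b i])
    \sum_(B : {set U} | B \subset [set i in Q | ~~ b i]) F A B.
Proof.
rewrite pair_big_dep /=.
rewrite (reindex_onto (fun I : {set U} => ([set i in I | b i], [set i in I | ~~ b i]))
  (fun AB => AB.1 :|: AB.2)) /=; last first.
  move=> [A B] /= /andP[/subsetP hA /subsetP hB]; congr pair;
    apply/setP => i; rewrite !inE.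
  - case iA: (i \in A); first by have := hA i iA; rewrite inE => /andP[_ ->].
    by case iB: (i \in B) => //=; have := hB i iB; rewrite inE => /andP[_ /negPf ->].
  - case iB: (i \in B); first by have := hB i iB; rewrite inE => /andP[_ ->]; rewrite orbT.
    by case iA: (i \in A) => //=; have := hA i iA; rewrite inE => /andP[_ ->].
apply: eq_bigl => I.
have -> : [set i in I | b i] :|: [set i in I | ~~ b i] = I.
  by apply/setP => i; rewrite !inE -andb_orr orbN andbT.
rewrite eqxx andbT; apply/idP/andP => [/subsetP IQ|[/subsetP h1 /subsetP h2]].
  by split; apply/subsetP => i; rewrite !inE => /andP[/IQ -> ->].
apply/subsetP => i iI; case bi: (b i).
  by have := h1 i; rewrite !inE iI bi => /(_ isT) /andP[].
by have := h2 i; rewrite !inE iI bi => /(_ isT) /andP[].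
Qed.

End SubsetSums.

(** * Counting the ideal below a partition *)

Section Count.
Variables (T : finType) (V1 : {set T}).
Local Notation U := ({set T} * option T)%type.
Implicit Types (P Q I : {set U}).

Definition pointed P := [set c in P | c.2 != None].
Definition unpointed P := [set c in P | ~~ (c.2 != None)].

Lemma card_pointedD Q : (#|pointed Q| + #|unpointed Q|)%N = #|Q|.
Proof.
rewrite -cardsUI [X in (_ + X)%N](_ : _ = 0%N) ?addn0; last first.
  by apply/eqP; rewrite cards_eq0; apply/eqP/setP => c; rewrite !inE;
     case: (c.2 != None); rewrite ?andbF.
by apply: eq_card => c; rewrite !inE; case: (c.2 != None);
   rewrite ?andbF ?andbT ?orbF.
Qed.

(** The values allowed at [x] once the image is [I]; the rank inequality is strict because [x] lies
    outside [I]. *)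
Definition targets Q I (x : U) : {set U} :=
  if x \in Q :\: I then
    [set i in I | [|| i.2 != None, x.2 != None | (rk i < rk x)%N]]
  else [set x].

(** Once the image is fixed, the conditions on the values at different blocks are independent, so
    the retractions form a product set. *)
Lemma retraction_family Q I (r : {ffun U -> U}) : I \subset Q ->
  retraction Q r && (r @: Q == I) = (r \in family (targets Q I)).
Proof.
move=> /subsetP IQ; apply/andP/familyP.
  case=> rr /eqP e x; rewrite /targets inE.
  case xQ: (x \in Q); last by rewrite andbF inE (retraction_out rr) ?xQ.
  rewrite andbT; case: ifP => xI; last first.
    have xr : x \in r @: Q by rewrite e (negbFE xI).
    by have [_ ->] := retraction_fix rr xr; rewrite inE.
  have rI : r x \in I by rewrite -e imset_f.
  rewrite inE rI /=; case r2: (r x).2 => [//|] /=; case x2: x.2 => [//|] /=.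
  rewrite ltn_neqAle (retraction_rank rr xQ x2 r2) andbT.
  apply: contra xI => /eqP h.
  by rewrite -(_ : r x = x) //; apply/enum_rank_inj/ord_inj.
move=> h.
have hI x : x \in I -> r x = x.
  by move=> xI; have := h x; rewrite /targets inE xI /= inE => /eqP.
have hQ x : x \in Q -> r x \in I.
  move=> xQ; have := h x; rewrite /targets inE xQ andbT.
  by case: ifP => [_|/negbFE xI]; rewrite inE; [case/andP|move=> /eqP ->].
split.
  apply/forallP => x; case xQ: (x \in Q); last first.
    by have := h x; rewrite /targets inE xQ andbF inE.
  have rI := hQ x xQ; rewrite IQ // hI // eqxx /=.
  apply/implyP => /andP[/eqP x2 /eqP r2]; have := h x.
  rewrite /targets inE xQ andbT; case: ifP => _; rewrite inE.
    by rewrite r2 x2 /= => /andP[_ /ltnW].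
  by move=> /eqP ->.
apply/eqP/setP => i; apply/imsetP/idP => [[x xQ ->]|iI]; first exact: hQ.
by exists i; rewrite ?hI ?IQ.
Qed.

(** Outside [I], a pointed block may go anywhere in [I], an unpointed one to a pointed block or to
    an unpointed one of smaller rank. *)
Lemma card_targets Q I : I \subset Q ->
  (#|family (targets Q I)| = #|I| ^ (#|pointed Q| - #|pointed I|) *
   \prod_(x in unpointed Q :\: unpointed I)
     (#|pointed I| + #|[set i in unpointed I | (rk i < rk x)%N]|))%N.
Proof.
move=> /subsetP IQ.
have -> : (#|family (targets Q I)| = \prod_x #|targets Q I x|)%N.
  by rewrite card_family /image_mem foldrE big_map big_enum.
rewrite (bigID (fun x => x \in Q :\: I)) /= [X in (_ * X)%N]big1 ?muln1; last first.
  by move=> x xQI; rewrite /targets (negPf xQI) cards1.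
rewrite (bigID (fun x => x.2 != None)) /=; congr (_ * _)%N.
  rewrite (eq_bigr (fun=> #|I|)) => [|x /andP[xQI x2]]; last first.
    rewrite /targets xQI; apply: eq_card => i; rewrite inE x2 orbT andbT //.
  rewrite prod_nat_const; congr (_ ^ _)%N.
  have sub : pointed I \subset pointed Q.
    by apply/subsetP => x; rewrite !inE => /andP[/IQ -> ->].
  rewrite -(cardsDS sub).
  apply: eq_card => x; rewrite !inE unfold_in /= !inE.
  by case: (x.2 != None); rewrite ?andbF ?andbT.
apply: eq_big => [x|x /andP[xQI x2]].
  by rewrite !inE; case: (x.2 != None); rewrite /= ?andbF ?andbT.
rewrite /targets xQI -cardsUI [X in (_ + X)%N](_ : _ = 0%N); last first.
  by apply/eqP; rewrite cards_eq0; apply/eqP/setP => i; rewrite !inE;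
     case: (i.2 != None); rewrite ?andbF.
rewrite addn0; apply: eq_card => i; rewrite !inE (negPf x2) /=.
by case: (i \in I) => //=; case: (i.2 != None).
Qed.

Lemma sum_ideal Q (F : nat -> nat -> rat) : sp_valid V1 Q ->
  \sum_(P : {set U} | sp_valid V1 P && sp_le P Q) F #|pointed P| #|unpointed P| =
  ideal_sum #|pointed Q| #|unpointed Q| F.
Proof.
move=> /sp_validP vQ.
rewrite (reindex_onto (glue Q) (unglue Q)) /=; last first.
  by move=> P /andP[/sp_validP vP PQ]; apply: (unglueK vQ vP PQ).
transitivity (\sum_(r | retraction Q r)
    F #|pointed (r @: Q)| #|unpointed (r @: Q)|).
  apply: eq_big => [r|r].
    apply/andP/idP => [[/andP[/sp_validP vP PQ] /eqP <-]|rr].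
      exact: (unglue_retraction vQ vP PQ).
    rewrite (glueK vQ rr) (glue_le vQ rr); split=> //; rewrite andbT.
    exact/sp_validP/(glue_semi_pointed vQ rr).
  move=> /andP[/andP[/sp_validP vP PQ] /eqP e].
  have rr : retraction Q r by rewrite -e; apply: (unglue_retraction vQ vP PQ).
  rewrite /pointed /unpointed (card_glue vQ (fun o => o != None) rr).
  by rewrite (card_glue vQ (fun o => ~~ (o != None)) rr).
(* Sort the retractions by their image [I], the set of representatives. *)
rewrite (partition_big (fun r : {ffun U -> U} => r @: Q)
  (fun I => I \subset Q)) /=; last first.
  move=> r rr; apply/subsetP => _ /imsetP[x xQ ->]; exact: retraction_in.
pose G (A B : {set U}) : rat := F #|A| #|B| *
  ((#|A| + #|B|)%:R ^+ (#|pointed Q| - #|A|) * \prod_(x in unpointed Q :\: B)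
     (#|A| + #|[set i in B | (rk i < rk x)%N]|)%:R).
transitivity (\sum_(I : {set U} | I \subset Q) G (pointed I) (unpointed I)).
  apply: eq_bigr => I IQ.
  rewrite (eq_bigl _ _ (fun r => retraction_family r IQ)).
  rewrite (eq_bigr (fun=> F #|pointed I| #|unpointed I|)); last first.
    by move=> r; rewrite -retraction_family // => /andP[_ /eqP ->].
  rewrite sumr_const card_targets // -[LHS]mulr_natr natrM natrX natr_prod /G.
  congr (_ * (_%:R ^+ _ * _)).
  by rewrite card_pointedD.
(* The pointed part [A] and the unpointed part [B] of [I] vary freely; the sum over [B] becomes
   [stir], the sum over [A] a binomial sum. *)
rewrite (sum_subset_pair Q (fun c : U => c.2 != None) G).
rewrite -/(pointed Q) -/(unpointed Q) /ideal_sum -(sum_subset_card (pointed Q)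
  (fun a => stir a #|unpointed Q| (fun b => (a + b)%:R ^+ (#|pointed Q| - a) * F a b))).
apply: eq_bigr => A _.
rewrite -(sum_subset_stir #|A| (unpointed Q)
  (fun b => (#|A| + b)%:R ^+ (#|pointed Q| - #|A|) * F #|A| b)).
by apply: eq_bigr => B _; rewrite /G mulrA [F _ _ * _]mulrC.
Qed.

End Count.

(** * Greatest and minimal elements *)

Section Extremal.
Variables (T : finType) (V1 : {set T}).
Implicit Types (P Q : spT T).

Definition top_block (x : T) : {set T} * option T :=
  ([set x], if x \in V1 then Some x else None).

Lemma top_block_inj : injective top_block.
Proof. by move=> x y [/set1_inj]. Qed.

Lemma sp_top_valid : sp_valid V1 (sp_top V1).
Proof.
apply/sp_validP; split.
- by move=> x; exists (top_block x); rewrite ?set11 ?imset_f.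
- move=> c d x /imsetP[y _ ->] /imsetP[z _ ->]; rewrite !inE.
  by move=> /eqP <- /eqP <-.
- by move=> c /imsetP[y _ ->]; exists y; rewrite set11.
- move=> c e /imsetP[y _ ->] /=; case: ifP => // yV [<-].
  by rewrite set11.
- by move=> c /imsetP[y _ ->] /=; case: ifP => // yV _; exists y; rewrite ?set11 ?yV.
Qed.

Lemma card_pointed_top : #|pointed (sp_top V1)| = #|V1|.
Proof.
rewrite -(card_imset (mem V1) top_block_inj); apply: eq_card => c; rewrite !inE.
apply/andP/imsetP => [[/imsetP[x _ ->]] /=|[x xV ->]].
  by case: ifP => // xV _; exists x => //; rewrite /top_block xV.
by split; [apply: (imset_f top_block) | rewrite /= (xV : x \in V1)].
Qed.

Lemma card_top : #|sp_top V1| = #|T|.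
Proof. exact: (card_imset _ top_block_inj). Qed.

Lemma one_block_valid (o : option T) :
  (if o is Some v then v \in V1 else ~~ ([set: T] \subset V1)) ->
  sp_valid V1 [set ([set: T], o)].
Proof.
move=> ho; apply/sp_validP; split.
- by move=> x; exists ([set: T], o); rewrite ?set11 ?inE.
- by move=> c d x /set1P -> /set1P ->.
- move=> c /set1P -> /=; case: o ho => [v _|/subsetPn[x]]; last by exists x.
  by exists v; rewrite inE.
- by move=> c e /set1P -> /= oe; move: ho; rewrite oe inE.
- by move=> c /set1P -> /= oe; move: ho; rewrite oe => /subsetPn[x]; exists x.
Qed.

Lemma sp_valid1 Q : sp_valid V1 Q -> #|Q| = 1%N ->
  exists2 o : option T, Q = [set ([set: T], o)] &
    (if o is Some v then v \in V1 else ~~ ([set: T] \subset V1)).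
Proof.
move=> /sp_validP vQ /eqP/cards1P[[B o] e]; subst Q.
have -> : B = [set: T].
  apply/setP => x; rewrite !inE; have [c] := block_cover vQ x.
  by move=> /set1P ->.
exists o => //; case: o vQ => [v|] vQ.
  by have [] := block_point vQ (set11 _) (erefl (Some v)).
by apply/subsetPn; have [x _ xV] := block_unpointed vQ (set11 _) (erefl None); exists x.
Qed.

(** A partition with a single block, pointed at v, equals m_v and no other m_w, so at most one term
    counts. *)
Lemma sum_sp_mv Q : sp_valid V1 Q ->
  \sum_(v in V1) (sp_mv v == Q)%:R =
  ((#|pointed Q| == 1%N) && (#|unpointed Q| == 0%N))%:R :> int.
Proof.
move=> vQ; case: andP => [[/eqP p1 /eqP q0]|npq]; last first.
  rewrite big1 // => v vV; case: eqP => // e; case: npq.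
  have -> : unpointed Q = set0.
    by rewrite -e; apply/setP => c; rewrite !inE; case: eqP => // ->.
  suff -> : pointed Q = Q by rewrite -e cards1 cards0.
  by rewrite -e; apply/setP => c; rewrite !inE; case: eqP => // ->.
have := card_pointedD Q; rewrite p1 q0 => /esym Q1.
have [o eQ ho] := sp_valid1 vQ Q1; case: o ho eQ => [v vV|_] eQ; last first.
  move: p1; rewrite (_ : pointed Q = set0) ?cards0 //.
  by rewrite eQ; apply/setP => c; rewrite !inE; case: eqP => // ->.
rewrite (bigD1 v) //= eQ eqxx big1 ?addr0 // => w /andP[_ nwv].
by case: eqP => // /set1_inj[wv]; rewrite wv eqxx in nwv.
Qed.

Lemma sp_minimalE Q : (0 < #|T|)%N -> sp_valid V1 Q ->
  sp_minimal V1 Q = (#|Q| == 1%N).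
Proof.
move=> /card_gt0P[x0 _] vQ; rewrite /sp_minimal vQ /=.
have /sp_validP sQ := vQ.
apply/forallP/eqP => [min|Q1 P].
  have [d dQ _] := block_cover sQ x0.
  (* Merging everything into one block with the pointing of some block [d] of [Q] gives an element
     below [Q]. *)
  have v1 : sp_valid V1 [set ([set: T], d.2)].
    apply: one_block_valid; case e: d.2 => [v|].
      by have [] := block_point sQ dQ e.
    by have [x _ xV] := block_unpointed sQ dQ e; apply/subsetPn; exists x.
  have := min [set ([set: T], d.2)]; rewrite v1 /=.
  move/implyP/(_ _)/eqP <-; first by rewrite cards1.
  have /sp_validP s1 := v1; apply/(sp_leP s1 sQ); split.
    by move=> e eQ; exists ([set: T], d.2); rewrite ?set11 ?subsetT.
  by move=> c /set1P ->; exists d; rewrite subsetT.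
apply/implyP => /andP[vP PQ]; apply/eqP.
apply: (sp_le_anti vP vQ PQ).
have [o eQ _] := sp_valid1 vQ Q1.
have /sp_validP sP := vP; have /(sp_leP sP sQ)[_ h] := PQ.
apply/(sp_leP sQ sP); rewrite eQ; split.
  by move=> c _; exists ([set: T], o); rewrite ?set11 ?subsetT.
move=> c /set1P ->; have [c' c'P _] := block_cover sP x0.
exists c'; rewrite subsetT; split=> //.
(* The only block of [Q] supplies the pointing of every block of [P]. *)
by have [d [dQ _ <-]] := h c' c'P; move: dQ; rewrite eQ => /set1P ->.
Qed.

End Extremal.

(** * The poset with an adjoined least element *)

Section Hat.
Variables (T : finType) (V1 : {set T}).
Implicit Types o : option (spT T).

Lemma hat_le_refl o : hat_valid V1 o -> hat_le o o.
Proof. by case: o => //= P; apply: sp_le_refl. Qed.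

Lemma hat_le_anti o o' : hat_valid V1 o -> hat_valid V1 o' ->
  hat_le o o' -> hat_le o' o -> o = o'.
Proof.
case: o o' => [P|] [Q|] //= vP vQ PQ QP.
by rewrite (sp_le_anti vP vQ PQ QP).
Qed.

Lemma hat_le_trans o1 o2 o3 : hat_valid V1 o1 -> hat_valid V1 o2 ->
  hat_valid V1 o3 -> hat_le o1 o2 -> hat_le o2 o3 -> hat_le o1 o3.
Proof. by case: o1 o2 o3 => [P|] [Q|] [R|] //=; apply: sp_le_trans. Qed.

(** The Moebius identity at hat0, with the term mu(hat0, hat0) = 1 moved to the right. *)
Lemma sum_hat_mobius (Q : spT T) : sp_valid V1 Q ->
  \sum_(P | sp_valid V1 P && sp_le P Q) hat_mobius V1 None (Some P) = -1.
Proof.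
move=> vQ.
have := @sum_mobius _ (hat_valid V1) (@hat_le T) hat_le_refl hat_le_anti
  hat_le_trans None (Some Q) isT vQ.
rewrite (bigD1 None) //= -/(hat_mobius V1 None None).
rewrite (reindex_omap Some id) /=; last by case=> [P|//]; rewrite ?eqxx ?andbF.
rewrite (eq_bigl (fun P => sp_valid V1 P && sp_le P Q)) => [|P]; last first.
  by rewrite eqxx !andbT.
rewrite {1}/hat_mobius (mobiusE hat_le_anti hat_le_trans) // eqxx => /eqP.
by rewrite addrC addr_eq0 => /eqP.
Qed.

End Hat.

(* V = T, V1 given, V2 = ~: V1 ; p = #|V1|, n = #|T|, (p,q) <> (0,0) iff n > 0. *)
Theorem mainTheorem8 (T : finType) (V1 : {set T}) :
  (0 < #|T|)%N ->
  ((0 < #|V1|)%N ->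
     ((\sum_(v in V1) sp_mobius V1 (sp_mv v) (sp_top V1))%:~R : rat)
     = (-1) ^+ (#|T|.-1) * ((#|T|.-1)`!%:R / (#|V1|.-1)`!%:R)
         * (#|T|%:R) ^+ (#|V1|.-1))
  /\
  ((0 < #|V1|)%N ->
     ((hat_mobius V1 None (Some (sp_top V1)))%:~R : rat)
     = (-1) ^+ #|T| * ((#|T|.-1)`!%:R / (#|V1|.-1)`!%:R)
         * ((#|T|.-1)%:R) ^+ (#|V1|.-1))
  /\
  (((\sum_(m : spT T | sp_minimal V1 m) sp_mobius V1 m (sp_top V1))%:~R : rat)
     = (-1) ^+ (#|T|.-1) * ((#|T|.-1)`!%:R / (#|V1|)`!%:R)
         * (#|T|%:R) ^+ #|V1|).
Proof.
move=> T0.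
(* Uniqueness: equal ideal sums force [f] to be [F] of the block numbers, in particular at the top,
   which has [#|V1|] pointed blocks. *)
have inj (F : nat -> nat -> rat) (f : spT T -> int) :
    (forall Q, sp_valid V1 Q ->
      (\sum_(P | sp_valid V1 P && sp_le P Q) f P)%:~R =
      ideal_sum #|pointed Q| #|unpointed Q| F) ->
    (f (sp_top V1))%:~R = F #|V1| #|unpointed (sp_top V1)|.
  move=> fF; rewrite -card_pointed_top.
  apply: (ideal_sum_inj (@sp_le_refl T V1) (@sp_le_anti T V1) (@sp_le_trans T V1)
    (f := fun P => (f P)%:~R) (g := fun P => F #|pointed P| #|unpointed P|));
    last exact: sp_top_valid.
  by move=> Q vQ; rewrite (sum_ideal F vQ) -fF // rmorph_sum.
have sum_mu (x Q : spT T) : sp_valid V1 x -> sp_valid V1 Q ->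
    \sum_(P | sp_valid V1 P && sp_le P Q) sp_mobius V1 x P = (x == Q)%:R.
  exact: (sum_mobius (@sp_le_refl T V1) (@sp_le_anti T V1) (@sp_le_trans T V1)).
have n_eq : #|T| = (#|V1| + #|unpointed (sp_top V1)|)%N.
  by rewrite -(card_pointed_top V1) card_pointedD card_top.
split; [|split].
- move=> p0; rewrite [LHS](inj mu_pointed
    (fun Q => \sum_(v in V1) sp_mobius V1 (sp_mv v) Q)).
    by rewrite mu_pointedE // -n_eq.
  (* After the exchange, the inner sum over the ideal is the indicator of m_v = Q. *)
  move=> Q vQ; rewrite exchange_big /= ideal_sum_pointed.
  rewrite (eq_bigr (fun v => (sp_mv v == Q)%:R)) => [|v vV].
    by rewrite sum_sp_mv //; case: (_ && _).
  by rewrite sum_mu //; apply: one_block_valid.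
- move=> p0; rewrite (inj mu_hat (fun Q => hat_mobius V1 None (Some Q))).
    by rewrite mu_hatE // -n_eq.
  by move=> Q vQ; rewrite ideal_sum_hat sum_hat_mobius.
- rewrite [LHS](inj mu_minimal
    (fun Q => \sum_(m | sp_minimal V1 m) sp_mobius V1 m Q)).
    by rewrite mu_minimalE -n_eq.
  move=> Q vQ; rewrite exchange_big /= ideal_sum_minimal card_pointedD.
  rewrite (eq_bigr (fun m => (m == Q)%:R)) => [|m /andP[vm _]]; last exact: sum_mu.
  (* [Q] has one block exactly when it is minimal, and only the term [m = Q] can count. *)
  rewrite -(sp_minimalE T0 vQ) (bigID (pred1 Q)) /= [X in _ + X]big1 ?addr0.
    case mQ: (sp_minimal V1 Q).
      rewrite (eq_bigl (pred1 Q)) ?big_pred1_eq ?eqxx //.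
      by move=> m /=; case: eqP => [->|]; rewrite ?mQ ?andbF.
    by rewrite big_pred0 // => m /=; case: eqP => [->|]; rewrite ?mQ ?andbF.
  by move=> m /andP[_ /negPf ->].
Qed.
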